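(* Let $B_+^\alpha$ be the causal B-spline of order $\alpha$, where $\alpha\in\mathbb{R}$, $\alpha>-1$, is an arbitrary number. Suppose the sequence $p$ is given by $p_k:=\binom{k+\alpha}{k}$ for $k\in\mathbb{Z}$, $k\ge 0$, and $p_k:=0$ for $k<0$. Then $$\sum_{k=0}^\infty p_k\,B_+^\alpha(x-k)=\sum_{k=0}^\infty\binom{k+\alpha}{k}B_+^\alpha(x-k)=x_+^\alpha .$$
   Context: The causal monomial is $x_+^\alpha:=x^\alpha$ for $x\ge 0$ and $x_+^\alpha:=0$ otherwise. Binomial coefficients are $\binom{m}{n}:=\dfrac{\Gamma(m+1)}{\Gamma(n+1)\Gamma(m-n+1)}$, with the usual convention $1/\Gamma=0$ at the poles of $\Gamma$. The causal B-spline of order $\alpha\in\mathbb{R}$, $\alpha>-1$, is $$B_+^\alpha(x):=\sum_{k\ge 0}(-1)^k\binom{\alpha+1}{k}(x-k)_+^\alpha .$$ B-splines are defined within constant factors, i.e. no prefactors are used in the definition. *)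

(* Defs.v *)
From mathcomp Require Import all_boot all_order all_algebra.
From mathcomp Require Import all_classical all_reals all_analysis.

Set Implicit Arguments.
Unset Strict Implicit.
Unset Printing Implicit Defensive.

Import Order.TTheory GRing.Theory Num.Theory.
Import numFieldNormedType.Exports.

Local Open Scope classical_set_scope.
Local Open Scope ring_scope.

(* The Gamma function for a positive argument. *)
Definition Euler_integral {R : realType} (x : R) : R :=
  \int[lebesgue_measure]_(t in `]0, +oo[) (t `^ (x - 1) * expR (- t)).

(* Number of unit shifts needed to make x positive. *)
Definition Gamma_shift {R : realType} (x : R) : nat :=
  if 0 < x then 0%N else (Num.truncn (- x)).+1.

(* Extension of the Euler integral to the whole line by the functional
   equation Gamma (y + 1) = y * Gamma y. At the poles 0, -1, -2, ... the product
   below vanishes, so that Gamma x = 0 and (Gamma x)^-1 = 0 since 0^-1 = 0: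
   this is the convention 1/Gamma = 0 at the poles (see inv_Gamma_pole). *)
Definition Gamma {R : realType} (x : R) : R :=
  Euler_integral (x + (Gamma_shift x)%:R) / \prod_(i < Gamma_shift x) (x + i%:R).

Lemma inv_Gamma_pole {R : realType} (n : nat) : (Gamma (- n%:R : R))^-1 = 0.
Proof.
rewrite /Gamma /Gamma_shift oppr_gt0 ltrn0 opprK natrK.
by rewrite big_ord_recr /= addNr mulr0 invr0 mulr0 invr0.
Qed.

Definition binom {R : realType} (m n : R) : R :=
  Gamma (m + 1) / (Gamma (n + 1) * Gamma (m - n + 1)).

(* powR gives 0 `^ 0 = 1, hence x_+^0 = 1 for all x >= 0; for alpha < 0, where
   0^alpha is not defined classically, it gives 0 `^ alpha = 0. *)
Definition causal_monomial {R : realType} (alpha x : R) : R :=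
  if 0 <= x then x `^ alpha else 0.

(* For each x only finitely many terms of the series are nonzero. *)
Definition Bspline {R : realType} (alpha x : R) : R :=
  limn (series (fun k : nat =>
    (-1) ^+ k * binom (alpha + 1) k%:R * causal_monomial alpha (x - k%:R))).

(* Main.v *)
Require Import Defs.
From mathcomp Require Import all_boot all_order all_algebra.
From mathcomp Require Import all_classical all_reals all_analysis.
From mathcomp Require Import measurable_realfun ring lra.

Import Order.TTheory GRing.Theory Num.Theory.
Import numFieldNormedType.Exports.

Local Open Scope classical_set_scope.
Local Open Scope ring_scope.

(** For fixed [x] every series in the statement has finitely many nonzero
terms, so the claim is a finite double sum.  With [c k] the coefficient
[binom (k + alpha) k] and [b j] the coefficient
[(-1) ^+ j * binom (alpha + 1) j], grouping the terms
[c k * b j * causal_monomial alpha (x - k - j)] according to [n = k + j]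
leaves the Cauchy products [\sum_k c k * b (n - k)], which are
[1] for [n = 0] and [0] otherwise: [c] and [b] are the Taylor coefficients of
[(1 - z)^-(alpha + 1)] and [(1 - z)^(alpha + 1)].

The Cauchy product is computed without power series ([conv_inverse]).  The two
sequences satisfy [k.+1 * c k.+1 = (k + a) * c k] and
[k.+1 * b k.+1 = (k - a) * b k] with [a = alpha + 1]; multiplying the
Cauchy product [S n.+1] by [n.+1 = k + (n.+1 - k)] term by term gives
[n.+1 * S n.+1 = n * S n], hence
[S n = 0] for [0 < n].

The two recurrences come from the functional equation of the Gamma function, in
the form [(Gamma x)^-1 = x * (Gamma (x + 1))^-1], which holds for every real
[x], poles included ([inv_Gamma]).  It rests on the functional equation of the
Euler integral for [0 < x], obtained by integrating by parts on segments that
exhaust the half-line and passing to the limit ([eGammaD1]); besides this one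
needs that the integral is finite and nonzero, and that it is [1] at [1]. *)

(** * The Euler integral as an extended real number *)

Local Notation mu := lebesgue_measure.

(** The Euler integral with values in the extended reals.  [Euler_integral] is
its [fine] part, which would be [0] if the integral were infinite. *)
Definition eGamma {R : realType} (x : R) : \bar R :=
  (\int[mu]_(t in `]0%R, +oo[) (t `^ (x - 1) * expR (- t))%:E)%E.

(** An increasing sequence of segments with union the positive half-line; the
index is shifted by two so that no segment is reduced to a point. *)
Definition exhaust {R : realType} (n : nat) : set R := `[n.+2%:R^-1, n.+2%:R].

Lemma exhaust_lt {R : realType} (n : nat) : n.+2%:R^-1 < n.+2%:R :> R.
Proof.
rewrite (@lt_trans _ _ 1) ?ltr1n// invf_lt1 ?ltr1n//.
Qed.

Lemma bigcup_exhaust {R : realType} :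
  \bigcup_n @exhaust R n = [set` `]0, +oo[%R].
Proof.
apply/seteqP; split => [t [n _]|t] /=.
  rewrite /exhaust/= !in_itv/= andbT => /andP[+ _]; apply: lt_le_trans.
  by rewrite invr_gt0.
rewrite in_itv/= andbT => t0.
exists (maxn (Num.truncn t) (Num.truncn t^-1)) => //.
rewrite /exhaust/= in_itv/=; apply/andP; split.
  rewrite -[leRHS]invrK lef_pV2 ?posrE ?invr_gt0// ltW//.
  apply: lt_le_trans (truncnS_gt _) _.
  by rewrite ler_nat ltnS (leq_trans (leq_maxr (Num.truncn t) _)).
apply/ltW/(lt_le_trans (truncnS_gt _)).
by rewrite ler_nat ltnS (leq_trans (leq_maxl _ (Num.truncn t^-1))).
Qed.

Lemma nondecreasing_exhaust {R : realType} : nondecreasing_seq (@exhaust R).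
Proof.
move=> m n mn; apply/subsetPset => t /=.
rewrite /exhaust/= !in_itv/= => /andP[tm tn]; apply/andP; split.
  by apply: le_trans tm; rewrite lef_pV2 ?posrE// ler_nat !ltnS.
by apply: le_trans tn _; rewrite ler_nat !ltnS.
Qed.

Lemma measurable_powR_expRN {R : realType} (a : R) (D : set R) :
  measurable_fun D (fun t : R => t `^ a * expR (- t)).
Proof.
apply: measurable_funTS; apply: measurable_funM; first exact: measurable_powR.
by apply: measurableT_comp => //.
Qed.

Lemma cvg_eGamma {R : realType} (x : R) :
  (\int[mu]_(t in exhaust n) (t `^ (x - 1) * expR (- t))%:E)%E
    @[n --> \oo] --> eGamma x.
Proof.
rewrite /eGamma -bigcup_exhaust.
apply: ge0_nondecreasing_set_cvg_integral.
- exact: nondecreasing_exhaust.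
- by move=> n; exact: measurable_itv.
- by move=> n; apply/measurable_EFinP; exact: measurable_powR_expRN.
- by move=> n t _; rewrite lee_fin mulr_ge0 ?powR_ge0 ?expR_ge0.
Qed.

Lemma derivable_oo_LRcontinuous_pos {R : realType} (f : R -> R) (a b : R) :
  0 < a -> a < b -> (forall t, 0 < t -> derivable f t 1) ->
  derivable_oo_LRcontinuous f a b.
Proof.
move=> a0 ab df.
have cf t : 0 < t -> {for t, continuous f}.
  by move=> t0; apply: differentiable_continuous; apply/derivable1_diffP/df.
split.
- by move=> t; rewrite in_itv/= => /andP[at0 _]; apply: df; exact: lt_trans at0.
- exact/cvg_at_right_filter/cf.
- exact/cvg_at_left_filter/cf/(lt_trans a0).
Qed.

Lemma is_derive_expRN {R : realType} (t : R) :
  is_derive t 1 (fun t : R => - expR (- t)) (expR (- t)).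
Proof.
apply: is_derive_eq.
by rewrite mulrN1 opprK.
Qed.

(** Integration by parts on a segment of the positive half-line, with
[- expR (- t)] as a primitive of [expR (- t)]. *)
Lemma powR_expR_parts {R : realType} (x a b : R) : 0 < a -> a < b ->
  (\int[mu]_(t in `[a, b]) (t `^ x * expR (- t))%:E =
   (a `^ x * expR (- a) - b `^ x * expR (- b))%:E +
   x%:E * \int[mu]_(t in `[a, b]) (t `^ (x - 1) * expR (- t))%:E)%E.
Proof.
move=> a0 ab.
have dpow (y t : R) : 0 < t -> derivable (@powR R ^~ y) t 1.
  by move=> t0; apply: derivable_powR; rewrite in_itv/= t0.
have dexp (t : R) : derivable (fun t : R => - expR (- t)) t 1.
  by have [] := is_derive_expRN t.
have cpow (y : R) : {within `[a, b], continuous (@powR R ^~ y)}.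
  apply: derivable_oo_LRcontinuous_within.
  by apply: derivable_oo_LRcontinuous_pos => // t; exact: dpow.
have cexp : {within `[a, b], continuous (fun t : R => expR (- t))}.
  apply: continuous_subspaceT => t.
  by apply: continuous_comp; [exact: opp_continuous|exact: continuous_expR].
rewrite (@integration_by_parts _ (@powR R ^~ x) (fun t => - expR (- t))
  (fun t => x * t `^ (x - 1)))//.
- have -> : (\int[mu]_(t in `[a, b]) (x * t `^ (x - 1) * - expR (- t))%:E =
      - (x%:E * \int[mu]_(t in `[a, b]) (t `^ (x - 1) * expR (- t))%:E))%E.
    rewrite -mulNe -EFinN -integralZl//.
      by apply: eq_integral => t _; rewrite -EFinM mulrN -mulrA mulNr.
    apply: continuous_compact_integrable; first exact: segment_compact.
    apply/subspace_continuousP => t tab.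
    apply: cvgM; last by move/subspace_continuousP : cexp; exact.
    by move/subspace_continuousP : (cpow (x - 1)); exact.
  by rewrite oppeK; congr (_%:E + _)%E; ring.
- apply/subspace_continuousP => t tab; apply: cvgM; first exact: cvg_cst.
  by move/subspace_continuousP : (cpow (x - 1)); exact.
- by apply: derivable_oo_LRcontinuous_pos => // t; exact: dpow.
- move=> t; rewrite in_itv/= => /andP[at0 _].
  by apply: powR_derive1; rewrite in_itv/= andbT (lt_trans a0).
- exact: derivable_oo_LRcontinuous_pos.
- by move=> t _; rewrite derive1E; have [_ ->] := is_derive_expRN t.
Qed.

Lemma cvg_powR_expRN_pinfty {R : realType} (x : R) :
  (n.+2%:R `^ x * expR (- n.+2%:R) : R) @[n --> \oo] --> (0 : R).
Proof.
(* With [N := truncn x], [t `^ x <= t ^+ N.+1] for [1 <= t], and the term of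
   degree [N.+2] of the exponential series bounds the product by
   [N.+2`! / t]. *)
pose N := Num.truncn x.
apply: (@squeeze_cvgr _ _ _ _ (fun=> 0)
  (fun n => N.+2`!%:R * @harmonic R n)); last 2 first.
- exact: cvg_cst.
- rewrite -[X in _ --> X](mulr0 (N.+2`!%:R : R)).
  by apply: cvgMr; exact: cvg_harmonic.
near=> n; rewrite mulr_ge0 ?powR_ge0 ?expR_ge0//=.
set t : R := n.+2%:R.
have t1 : 1 <= t by rewrite ler1n.
have t0 : 0 < t by exact: lt_le_trans t1.
have le_pow : t `^ x <= t ^+ N.+1.
  rewrite -(powR_mulrn N.+1 (ltW t0)).
  by apply: ler_powR => //; exact/ltW/truncnS_gt.
have le_exp : t ^+ N.+2 / N.+2`!%:R <= expR t.
  by apply: le_trans (expR_ge1Dxn N.+1 (ltW t0)); rewrite lerDr.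
apply: (@le_trans _ _ (N.+2`!%:R * t^-1)); last first.
  by rewrite ler_wpM2l// lef_pV2 ?posrE// ler_nat.
rewrite expRN ler_pdivrMr ?expR_gt0//.
apply: (le_trans le_pow).
rewrite -mulrA -ler_pdivrMl ?ltr0n ?fact_gt0//.
rewrite ler_pdivlMl// mulrCA -exprS mulrC; exact: le_exp.
Unshelve. end_near. Qed.

Lemma cvg_powR_expRN0 {R : realType} (x : R) : 0 < x ->
  (n.+2%:R^-1 `^ x * expR (- n.+2%:R^-1) : R) @[n --> \oo] --> (0 : R).
Proof.
move=> x0.
apply: (@squeeze_cvgr _ _ _ _ (fun=> 0)
  (fun n => n.+2%:R^-1 `^ x)); last 2 first.
- exact: cvg_cst.
- apply: (cvg_at_rightP (@powR R ^~ x) 0 0).1 (powR_cvg0 x0) _ _; split => // n.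
  by have := @cvg_harmonic R; rewrite -cvg_shiftS; exact.
near=> n; rewrite mulr_ge0 ?powR_ge0 ?expR_ge0//=.
by rewrite ler_piMr ?powR_ge0// expR_le1 oppr_le0.
Unshelve. end_near. Qed.

(** The functional equation, in the extended reals: no finiteness is needed,
since the boundary terms of the integration by parts tend to [0]. *)
Lemma eGammaD1 {R : realType} (x : R) : 0 < x ->
  (eGamma (x + 1) = x%:E * eGamma x)%E.
Proof.
move=> x0.
pose bdry (n : nat) : R := n.+2%:R^-1 `^ x * expR (- n.+2%:R^-1)
  - n.+2%:R `^ x * expR (- n.+2%:R).
suff lim_parts : ((bdry n)%:E + x%:E * \int[mu]_(t in exhaust n)
    (t `^ (x - 1) * expR (- t))%:E)%E @[n --> \oo] --> (0 + x%:E * eGamma x)%E.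
  rewrite -[RHS]add0e.
  apply: (cvg_unique (@ereal_hausdorff R) (cvg_eGamma (x + 1))).
  rewrite (_ : (fun n => _) = (fun n => (bdry n)%:E + x%:E *
      \int[mu]_(t in exhaust n) (t `^ (x - 1) * expR (- t))%:E)%E) //.
  by apply/funext => n; rewrite addrK powR_expR_parts ?exhaust_lt.
apply: cvgeD; first by [].
- apply: cvg_EFin; first exact: nearW.
  rewrite -(subr0 0).
  apply: cvgB; [exact: cvg_powR_expRN0|exact: cvg_powR_expRN_pinfty].
- by apply: cvgeZl => //; exact: cvg_eGamma.
Qed.

Lemma eGamma1 {R : realType} : eGamma (1 : R) = 1%E.
Proof.
rewrite /eGamma subrr.
under eq_integral => t _ do rewrite powRr0 mul1r.
have cexp : continuous (fun t : R => expR (- t)).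
  move=> t.
  by apply: continuous_comp; [exact: opp_continuous|exact: continuous_expR].
rewrite integral_itv_obnd_cbnd; last first.
  apply/measurable_EFinP/measurable_funTS.
  exact: (continuous_measurable_fun cexp).
rewrite (@ge0_continuous_FTC2y _ _ (fun t => - expR (- t)) _ 0).
- by rewrite oppr0 expR0 EFinN oppeK add0e.
- by move=> t _; exact: expR_ge0.
- exact: continuous_subspaceT.
- by rewrite -[X in _ --> X]oppr0; apply: cvgN; exact: cvgr_expR.
- by move=> t _; have [] := is_derive_expRN t.
- by apply: cvg_at_right_filter; apply: cvgN; exact: cexp.
- by move=> t _; rewrite derive1E; have [_ ->] := is_derive_expRN t.
Qed.

Lemma eGamma_nat {R : realType} (n : nat) :
  eGamma (n.+1%:R : R) = (n`!%:R)%:E.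
Proof.
elim: n => [|n IHn]; first exact: eGamma1.
by rewrite -natr1 eGammaD1// IHn -EFinM -natrM factS.
Qed.

Lemma eGamma_ge0 {R : realType} (x : R) : (0 <= eGamma x)%E.
Proof.
by apply: integral_ge0 => t _; rewrite lee_fin mulr_ge0 ?powR_ge0 ?expR_ge0.
Qed.

(** For [1 <= x], [t `^ (x - 1)] is at most [1 + t ^+ N.+1] with
[N := truncn x], so the integral is bounded by [1 + N.+1`!]; the functional
equation extends this to [0 < x]. *)
Lemma eGamma_lty {R : realType} (x : R) : 0 < x -> (eGamma x < +oo)%E.
Proof.
have ge1 (y : R) : 1 <= y -> (eGamma y < +oo)%E.
  move=> y1; pose N := Num.truncn y.
  have : (eGamma y <= eGamma (1 : R) + eGamma (N.+2%:R : R))%E.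
    rewrite /eGamma -ge0_integralD//=; last 4 first.
    - by move=> t _; rewrite lee_fin mulr_ge0 ?powR_ge0 ?expR_ge0.
    - by apply/measurable_EFinP; exact: measurable_powR_expRN.
    - by move=> t _; rewrite lee_fin mulr_ge0 ?powR_ge0 ?expR_ge0.
    - by apply/measurable_EFinP; exact: measurable_powR_expRN.
    apply: ge0_le_integral => //=.
    - by move=> t _; rewrite lee_fin mulr_ge0 ?powR_ge0 ?expR_ge0.
    - by apply/measurable_EFinP; exact: measurable_powR_expRN.
    - apply/measurable_EFinP; apply: measurable_funD;
        exact: measurable_powR_expRN.
    move=> t; rewrite in_itv/= andbT => t0.
    rewrite -EFinD lee_fin -mulrDl ler_wpM2r ?expR_ge0// subrr powRr0.
    have [t1|/ltW t1] := leP t 1.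
      apply: (@le_trans _ _ 1); last by rewrite lerDl powR_ge0.
      rewrite -[leRHS](powRr0 t); apply: ger_powR; first by rewrite t0.
      by rewrite subr_ge0.
    apply: (@le_trans _ _ (t `^ (N.+2%:R - 1))); last by rewrite lerDr.
    apply: ler_powR => //; rewrite lerD2r ltW//.
    by apply: lt_le_trans (truncnS_gt _) _; rewrite ler_nat.
  by move=> /le_lt_trans; apply; rewrite eGamma1 eGamma_nat -EFinD ltry.
move=> x0; rewrite ltey; apply/eqP => Gxy.
have : (eGamma (x + 1)%R < +oo)%E by apply: ge1; rewrite lerDr ltW.
by rewrite eGammaD1// Gxy gt0_muley ?lte_fin// ltxx.
Qed.

(** For [1 <= x] the integrand is at least [expR (- 2)] between [1] and [2]; the
functional equation extends this to [0 < x]. *)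
Lemma eGamma_gt0 {R : realType} (x : R) : 0 < x -> (0 < eGamma x)%E.
Proof.
have ge1 (y : R) : 1 <= y -> (0 < eGamma y)%E.
  move=> y1.
  have : (\int[mu]_(t in `[1%R, 2%R]) (cst (expR (- 2))%:E t) <= eGamma y)%E.
    apply: (@le_trans _ _
      (\int[mu]_(t in `[1%R, 2%R]) (t `^ (y - 1) * expR (- t))%:E)%E).
      apply: ge0_le_integral => //=.
      - by apply/measurable_EFinP; exact: measurable_powR_expRN.
      move=> t; rewrite in_itv/= => /andP[t1 t2]; rewrite lee_fin.
      rewrite -[leLHS]mul1r ler_pM ?expR_ge0//; last by rewrite ler_expR lerN2.
      by rewrite -[leLHS](powRr0 t); apply: ler_powR; rewrite ?subr_ge0.
    apply: ge0_subset_integral => //=.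
    - by apply/measurable_EFinP; exact: measurable_powR_expRN.
    - by move=> t _; rewrite lee_fin mulr_ge0 ?powR_ge0 ?expR_ge0.
    - move=> t /=; rewrite !in_itv/= andbT => /andP[t1 _].
      exact: lt_le_trans t1.
  rewrite integral_cst//= lebesgue_measure_itv/= lte_fin ltr1n/=.
  apply: lt_le_trans; rewrite -EFinB -EFinM lte_fin mulr_gt0 ?expR_gt0//.
move=> x0; rewrite lt_neqAle eGamma_ge0 andbT; apply/eqP => Gx0.
have : (0 < eGamma (x + 1)%R)%E by apply: ge1; rewrite lerDr ltW.
by rewrite eGammaD1// -Gx0 mule0 ltxx.
Qed.

(** * The Gamma function on the real line *)

Lemma Euler_integralE {R : realType} (x : R) :
  Euler_integral x = fine (eGamma x).
Proof. by []. Qed.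

Lemma Euler_integralD1 {R : realType} (x : R) : 0 < x ->
  Euler_integral (x + 1) = x * Euler_integral x.
Proof.
move=> x0; rewrite !Euler_integralE eGammaD1// fineM//.
by rewrite ge0_fin_numE ?eGamma_ge0 ?eGamma_lty.
Qed.

Lemma Euler_integral_gt0 {R : realType} (x : R) : 0 < x -> 0 < Euler_integral x.
Proof.
by move=> x0; rewrite Euler_integralE fine_gt0// eGamma_gt0 ?eGamma_lty.
Qed.

Lemma Euler_integral1 {R : realType} : Euler_integral (1 : R) = 1.
Proof. by rewrite Euler_integralE eGamma1. Qed.

Lemma Gamma_shift_gt0 {R : realType} (x : R) : 0 < x -> Gamma_shift x = 0%N.
Proof. by rewrite /Gamma_shift => ->. Qed.

Lemma Gamma_shift_le0 {R : realType} (x : R) : x <= 0 ->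
  Gamma_shift x = (Gamma_shift (x + 1)).+1.
Proof.
move=> x0; rewrite /Gamma_shift ltNge x0/=; case: ifPn => [x1|].
  by apply/congr1/truncn0Pn; rewrite -ltNge; lra.
rewrite -leNgt => x1.
have -> : - x = - (x + 1) + 1 by ring.
by rewrite [- _ + 1]addrC truncnD ?truncn1 ?nnegrE ?oppr_ge0.
Qed.

Lemma Gamma_gt0E {R : realType} (x : R) : 0 < x -> Gamma x = Euler_integral x.
Proof.
by move=> x0; rewrite /Gamma Gamma_shift_gt0// addr0 big_ord0 divr1.
Qed.

Lemma GammaD1 {R : realType} (x : R) : 0 < x -> Gamma (x + 1) = x * Gamma x.
Proof. by move=> x0; rewrite !Gamma_gt0E ?addr_gt0// Euler_integralD1. Qed.

Lemma Gamma_gt0 {R : realType} (x : R) : 0 < x -> 0 < Gamma x.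
Proof. by move=> x0; rewrite Gamma_gt0E// Euler_integral_gt0. Qed.

Lemma Gamma1 {R : realType} : Gamma (1 : R) = 1.
Proof. by rewrite Gamma_gt0E// Euler_integral1. Qed.

(** The functional equation of [1 / Gamma] has no exception: at a pole [x]
the left-hand side is [0], and so is the right-hand side, since [x + 1] is
again a pole unless [x = 0], when the factor [x] vanishes. *)
Lemma inv_Gamma {R : realType} (x : R) :
  (Gamma x)^-1 = x * (Gamma (x + 1))^-1.
Proof.
have [x0|x0] := ltP 0 x.
  by rewrite GammaD1// [(x * Gamma x)^-1]invfM mulrA divff ?mul1r// gt_eqF.
rewrite /Gamma (Gamma_shift_le0 _ x0); set k := Gamma_shift (x + 1).
rewrite big_ord_recl addr0 !invfM !invrK -natr1.
have -> : x + (k%:R + 1) = x + 1 + k%:R by ring.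
rewrite mulrCA; congr (_ * (_ * _)).
by apply: eq_bigr => i _; rewrite /= /bump/= natrD; ring.
Qed.

(** * Recurrences for the binomial coefficients *)

Lemma binom0 {R : realType} (m : R) : -1 < m -> binom m 0 = 1.
Proof.
move=> m1; rewrite /binom add0r Gamma1 subr0 mul1r divff// gt_eqF// Gamma_gt0//.
lra.
Qed.

Lemma binomE {R : realType} (m n : R) :
  binom m n = Gamma (m + 1) * (Gamma (n + 1))^-1 * (Gamma (m - n + 1))^-1.
Proof. by rewrite /binom invfM mulrA. Qed.

Lemma binomS {R : realType} (m : R) (k : nat) :
  k.+1%:R * binom m k.+1%:R = (m - k%:R) * binom m k%:R.
Proof.
rewrite !binomE (inv_Gamma (k%:R + 1)) -!natr1.
have -> : m - (k%:R + 1) + 1 = m - k%:R by ring.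
by rewrite (inv_Gamma (m - k%:R)); ring.
Qed.

(** The recurrence along a diagonal, where both arguments grow. *)
Lemma binomSS {R : realType} (a : R) (k : nat) : -1 < a ->
  k.+1%:R * binom (k.+1%:R + a) k.+1%:R =
  (k.+1%:R + a) * binom (k%:R + a) k%:R.
Proof.
move=> a1; rewrite !binomE (inv_Gamma (k%:R + 1)) -!natr1.
have -> : k%:R + 1 + a - (k%:R + 1) + 1 = a + 1 by ring.
have -> : k%:R + a - k%:R + 1 = a + 1 by ring.
have -> : k%:R + a + 1 = k%:R + 1 + a by ring.
rewrite GammaD1; first by ring.
by have := ler0n R k; lra.
Qed.

(** * Convolution inverses *)

(** Sequences satisfying the recurrences of the Taylor coefficients of
[(1 - z)^a] and [(1 - z)^-a] are inverse to each other for the Cauchy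
product. *)
Lemma conv_inverse {R : numFieldType} (a : R) (b c : nat -> R) :
  b 0%N = 1 -> c 0%N = 1 ->
  (forall k, k.+1%:R * b k.+1 = (k%:R - a) * b k) ->
  (forall k, k.+1%:R * c k.+1 = (k%:R + a) * c k) ->
  forall n, \sum_(0 <= k < n.+1) c k * b (n - k)%N = (n == 0%N)%:R.
Proof.
move=> b0 c0 bS cS.
pose S n := \sum_(0 <= k < n.+1) c k * b (n - k)%N.
have rec n : n.+1%:R * S n.+1 = n%:R * S n.
  (* Write [n.+1 = k + (n.+1 - k)] in the term of index [k]. *)
  have -> : n.+1%:R * S n.+1 =
      \sum_(0 <= k < n.+2) (k%:R * c k) * b (n.+1 - k)%N +
      \sum_(0 <= k < n.+2) c k * ((n.+1 - k)%:R * b (n.+1 - k)%N).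
    rewrite /S -big_split mulr_sumr; apply: eq_big_nat => k /=.
    by rewrite ltnS => kn; rewrite natrB//; ring.
  rewrite big_nat_recl//= !mul0r add0r.
  rewrite [X in _ + X]big_nat_recr//= subnn !mul0r mulr0 addr0.
  rewrite -big_split mulr_sumr; apply: eq_big_nat => k /=.
  rewrite ltnS => kn; rewrite cS subSS subSn// bS natrB//; ring.
have S0 n : n.+1%:R * S n.+1 = 0.
  by elim: n => [|n IHn]; rewrite rec ?mul0r.
case=> [|n]; first by rewrite big_nat1 b0 c0 mulr1.
by apply: (mulfI (_ : n.+1%:R != 0)); rewrite ?pnatr_eq0// mulr0 S0.
Qed.

(** * Finite sums of B-splines *)

Lemma cvg_series_fin {R : realType} (u : nat -> R) (N : nat) :
  (forall k, (N <= k)%N -> u k = 0) ->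
  series u @ \oo --> \sum_(0 <= k < N) u k.
Proof.
move=> u0; apply: cvg_near_cst; exists N => // n /= Nn.
rewrite /series/= (big_cat_nat (leq0n N) Nn)//= [X in _ + X]big_nat_cond.
by rewrite [X in _ + X]big1 ?addr0// => k /andP[/andP[Nk _] _]; exact: u0.
Qed.

Lemma causal_monomial_lt0 {R : realType} (a y : R) : y < 0 ->
  causal_monomial a y = 0.
Proof. by rewrite /causal_monomial leNgt => ->. Qed.

(** Any truncation beyond [y] computes the B-spline at [y]; in particular it is
[0] for [y < 0]. *)
Lemma BsplineE {R : realType} (a y : R) (N : nat) : y < N%:R ->
  Bspline a y = \sum_(0 <= j < N)
    (-1) ^+ j * binom (a + 1) j%:R * causal_monomial a (y - j%:R).
Proof.
move=> yN; apply/cvg_lim => //; apply: cvg_series_fin => k Nk.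
rewrite causal_monomial_lt0 ?mulr0// subr_lt0 (lt_le_trans yN)//.
by rewrite ler_nat.
Qed.

Lemma sum_Bspline {R : realType} (a x : R) (N : nat) : -1 < a ->
    x < N.+1%:R ->
  \sum_(0 <= k < N.+1) binom (k%:R + a) k%:R * Bspline a (x - k%:R) =
  causal_monomial a x.
Proof.
move=> a1 xN.
pose b j : R := (-1) ^+ j * binom (a + 1) j%:R.
pose c k : R := binom (k%:R + a) k%:R.
have bc n : \sum_(0 <= k < n.+1) c k * b (n - k)%N = (n == 0%N)%:R.
  apply: (@conv_inverse _ (a + 1)).
  - by rewrite /b mul1r binom0//; lra.
  - by rewrite /c add0r binom0.
  - by move=> k; rewrite /b exprS mulrCA binomS; ring.
  - by move=> k; rewrite /c binomSS// -natr1; ring.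
(* Truncate the B-spline at [x - k] after [N.+1 - k] terms and index them by
   [n = k + j]. *)
transitivity (\sum_(0 <= k < N.+1) \sum_(0 <= n < N.+1 | (k <= n)%N)
    c k * b (n - k)%N * causal_monomial a (x - n%:R)).
  apply: eq_big_nat => k /= kN; rewrite (BsplineE _ _ (N.+1 - k)%N); last first.
    by rewrite natrB ?ltrD2r// ltnW.
  rewrite mulr_sumr.
  rewrite -(big_nat_widenl k 0%N _ xpredT)//.
  rewrite -[X in _ = \sum_(X <= _ < _) _]add0n big_addn.
  apply: eq_bigr => j _; rewrite addnK natrD.
  have -> : x - k%:R - j%:R = x - (j%:R + k%:R) by ring.
  by rewrite mulrA.
rewrite (exchange_big_dep_nat xpredT)//=.
transitivity (\sum_(0 <= n < N.+1)
    (n == 0%N)%:R * causal_monomial a (x - n%:R)).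
  apply: eq_big_nat => n /= nN.
  by rewrite -bc mulr_suml (big_nat_widen _ _ _ _ _ nN).
by rewrite big_nat_recl//= mul1r subr0 big1 ?addr0// => i _; rewrite mul0r.
Qed.

Theorem theorem4p1 (R : realType) (alpha : R) (halpha : -1 < alpha)
    (p : int -> R)
    (hp : forall k : nat, p k%:Z = binom (k%:R + alpha) k%:R)
    (hp0 : forall k : int, k < 0 -> p k = 0)
    (x : R) :
  [/\ cvgn (series (fun k : nat => p k%:Z * Bspline alpha (x - k%:R))),
      limn (series (fun k : nat => p k%:Z * Bspline alpha (x - k%:R))) =
      limn (series (fun k : nat =>
        binom (k%:R + alpha) k%:R * Bspline alpha (x - k%:R))) &
      limn (series (fun k : nat =>
        binom (k%:R + alpha) k%:R * Bspline alpha (x - k%:R))) =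
      causal_monomial alpha x].
Proof.
have pE : (fun k : nat => p k%:Z * Bspline alpha (x - k%:R)) =
    (fun k : nat => binom (k%:R + alpha) k%:R * Bspline alpha (x - k%:R)).
  by apply/funext => k; rewrite hp.
have xN := truncnS_gt x.
have cvgS : series (fun k : nat =>
    binom (k%:R + alpha) k%:R * Bspline alpha (x - k%:R)) @ \oo -->
    causal_monomial alpha x.
  rewrite -(sum_Bspline _ _ _ halpha xN); apply: cvg_series_fin => k Nk.
  rewrite (BsplineE _ _ 0) ?big_nil ?mulr0//.
  by rewrite subr_lt0 (lt_le_trans xN)// ler_nat.
by rewrite pE; split => //; [apply: cvgP cvgS|apply: cvg_lim].
Qed.
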